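(* Let $p$ be a Gauss phrase. Then $S(p)$ is a homotopy invariant of $p$; that is, if $p$ and $q$ are homotopic $n$-component Gauss phrases, then $S(p)=S(q)$.
   Context: A word on an alphabet (finite set) $\mathcal{A}$ is a finite, possibly empty, sequence of letters of $\mathcal{A}$. A Gauss word on $\mathcal{A}$ is a word on $\mathcal{A}$ in which every letter of $\mathcal{A}$ appears exactly twice. A Gauss phrase on $\mathcal{A}$ is a finite sequence of words $x_1,\dots,x_m$ on $\mathcal{A}$ (written $x_1|\cdots|x_m$) whose concatenation $x_1x_2\cdots x_m$ is a Gauss word on $\mathcal{A}$; the $x_i$ are its components. Different Gauss phrases may have different alphabets. Isomorphism: Gauss phrases $p_1$ on $\mathcal{A}_1$ and $p_2$ on $\mathcal{A}_2$ are isomorphic if there is a bijection $\mathcal{A}_1\to\mathcal{A}_2$ which applied letterwise to $p_1$ gives $p_2$. Homotopy moves. Below $A,B,C$ are individual (distinct) letters, and $w,x,y,z$ are arbitrary (possibly empty) sequences of letters, possibly including the separator $|$; each move starts and ends with a Gauss phrase. H1: $xAAy \to xy$. H2: $xAByBAz \to xyz$. H3: $wABxACyBCz \to wBAxCAyCBz$. (In each move each displayed two-letter subword lies in a single component; different subwords may lie in the same or different components. The inverses of H1 and H2 insert letters not already appearing in the phrase.) Shift move: if the $k$th component is $Ay$ with $A$ a letter, replace it by $yA$, leaving the other components unchanged. Two Gauss phrases are homotopic if they are related by a finite sequence of isomorphisms, shift moves, and the moves H1, H2, H3 and their inverses. All these operations preserve the number and order of components. Write $K_n=(\mathbb{Z}/2\mathbb{Z})^n$.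 Let $p$ be an $n$-component Gauss phrase. For a (contiguous) subword $w$ of a component of $p$, the linking vector $\overrightarrow{l(w)}\in K_n$ is the vector whose $i$th entry is the number, modulo $2$, of letters which occur exactly once in $w$ and whose other occurrence is in the $i$th component of $p$. A single-component letter is a letter both of whose occurrences are in the same component. If $A$ is a single-component letter in the $k$th component, that component has the form $xAyAz$ with $x,y,z$ possibly empty words, and the linking vector of $A$ is $\overrightarrow{l(A)}=\overrightarrow{l(y)}$. For $\vec u\in K_n$, let $c_{\vec u}:K_n\to K_n$, $c_{\vec u}(\vec v)=\vec u+\vec v$, and let $K(\vec u)$ be the set of orbits of $K_n$ under $c_{\vec u}$ (so the orbit of $\vec v$ is $[\vec v]=\{\vec v,\vec u+\vec v\}$). Let $\vec l_k$ be the linking vector of the whole $k$th component of $p$, let $\mathcal{A}_k$ be the set of single-component letters appearing in the $k$th component, and for $[\vec v]\in K(\vec l_k)$ let $d_k([\vec v])=\#\{X\in\mathcal{A}_k : \overrightarrow{l(X)}\in[\vec v]\}$. Define $$O_k(p)=\{[\vec v]\in K(\vec l_k)-\{[\vec 0]\} : d_k([\vec v])\text{ is odd}\},$$ $S_k(p)=(\vec l_k,O_k(p))$, and $S(p)=(S_1(p),\dots,S_n(p))$. *)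

(* Defs.v *)
From Stdlib Require Import Relation_Operators.
From mathcomp Require Import all_boot all_order all_algebra.
From mathcomp Require Import finmap.

Set Implicit Arguments.
Unset Strict Implicit.
Unset Printing Implicit Defensive.

Import GRing.Theory.

(* Alphabets are finite subsets of an arbitrary ambient type T of letters, so
   that phrases with different alphabets can be compared. *)

Definition gauss_word (T : choiceType) (A : {fset T}) (w : seq T) : Prop :=
  {subset w <= A} /\ (forall a, a \in A -> count_mem a w = 2).

Record gauss_phrase (T : choiceType) (n : nat) := GaussPhrase {
  alphabet : {fset T};
  comps : n.-tuple (seq T);
  comps_gauss : gauss_word alphabet (flatten comps) }.

Definition component (T : choiceType) n (p : gauss_phrase T n) (k : 'I_n) : seq T :=
  tnth (comps p) k.

(* x_1|...|x_m as a single sequence; None stands for the separator |. *)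
Definition barred (T : Type) (s : seq (seq T)) : seq (option T) :=
  if s is x :: s' then
    map Some x ++ flatten [seq None :: map Some y | y <- s']
  else [::].

Section Moves.
Variables (T : choiceType) (n : nat).
Implicit Types (p q : gauss_phrase T n) (w x y z : seq (option T)).

Definition isomorphic p q : Prop :=
  exists f : T -> T,
    [/\ {in alphabet p &, injective f},
        (f @` alphabet p)%fset = alphabet q
      & map_tuple (map f) (comps p) = comps q].

Definition shift_move p q : Prop :=
  exists (k : 'I_n) (A : T) (y : seq T),
    [/\ component p k = A :: y, component q k = rcons y A
      & forall j, j != k -> component q j = component p j].

(* In H1 and H2, since p is a Gauss phrase, the removed letters do not occur in
   q: read from q to p, the moves insert letters that are new to q. *)
Definition H1 p q : Prop :=
  exists (A : T) x y,
    barred (comps p) = x ++ [:: Some A; Some A] ++ y /\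
    barred (comps q) = x ++ y.

Definition H2 p q : Prop :=
  exists (A B : T) x y z,
    [/\ A != B,
        barred (comps p) =
          x ++ [:: Some A; Some B] ++ y ++ [:: Some B; Some A] ++ z
      & barred (comps q) = x ++ y ++ z].

Definition H3 p q : Prop :=
  exists (A B C : T) w x y z,
    [/\ uniq [:: A; B; C],
        barred (comps p) =
          w ++ [:: Some A; Some B] ++ x ++ [:: Some A; Some C] ++ y ++
          [:: Some B; Some C] ++ z
      & barred (comps q) =
          w ++ [:: Some B; Some A] ++ x ++ [:: Some C; Some A] ++ y ++
          [:: Some C; Some B] ++ z].

Definition elementary_move p q : Prop :=
  [\/ isomorphic p q, shift_move p q | [\/ H1 p q, H2 p q | H3 p q]].

Definition homotopic : gauss_phrase T n -> gauss_phrase T n -> Prop :=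
  clos_refl_sym_trans (gauss_phrase T n) elementary_move.

End Moves.

Notation K n := 'rV['F_2]_n.

Definition translation n (u v : K n) : K n := (u + v)%R.

Definition cls n (u v : K n) : {set K n} :=
  [set x in fingraph.orbit (translation u) v].

Definition Kquot n (u : K n) : {set {set K n}} := [set cls u v | v : K n].

Lemma clsE n (u v : K n) : cls u v = [set v; (u + v)%R].
Proof.
have tK : involutive (translation u).
  move=> x; rewrite /translation addrA; suff -> : (u + u = 0)%R by rewrite add0r.
  by apply/rowP => i; rewrite !mxE -mulr2n -mulr_natr pchar_Zp ?mulr0.
apply/setP=> x; rewrite !inE -fconnect_orbit.
apply/idP/idP => [/iter_findex <- | /orP[] /eqP ->].
- elim: (findex _ _ _) => [|m]; first by rewrite eqxx.
  by rewrite iterS => /orP[] /eqP ->; rewrite ?tK eqxx ?orbT.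
- exact: connect0.
- exact: fconnect1.
Qed.

(* The word y such that w = xAyAz, when A occurs exactly twice in w. *)
Definition between (T : eqType) (A : T) (w : seq T) : seq T :=
  let s := drop (index A w).+1 w in take (index A s) s.

Lemma betweenE (T : eqType) (A : T) (x y z : seq T) :
  count_mem A (x ++ A :: y ++ A :: z) = 2 ->
  between A (x ++ A :: y ++ A :: z) = y.
Proof.
rewrite count_cat /= count_cat /= eqxx !add1n !addnS => -[] /eqP.
rewrite !addn_eq0 => /and3P[/eqP/count_memPn Ax /eqP/count_memPn Ay _].
rewrite /between index_cat (negPf Ax) /= eqxx addn0 -cat_rcons.
by rewrite drop_size_cat ?size_rcons // index_cat (negPf Ay) /= eqxx addn0
           take_size_cat.
Qed.

Section Invariant.
Variables (T : choiceType) (n : nat) (p : gauss_phrase T n).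

(* For w a subword of component k: a letter occurring exactly once in w has its
   other occurrence in component k iff component k contains it twice. *)
Definition linking_vector (k : 'I_n) (w : seq T) : K n :=
  (\row_(i < n)
    #|` [fset a in alphabet p | (count_mem a w == 1%N) &&
          (if i == k then count_mem a (component p k) == 2%N
           else a \in component p i)]%fset |%:R)%R.

Definition component_linking_vector (k : 'I_n) : K n :=
  linking_vector k (component p k).

Definition single_component_letters (k : 'I_n) : {fset T} :=
  [fset a in alphabet p | count_mem a (component p k) == 2]%fset.

Definition letter_linking_vector (k : 'I_n) (A : T) : K n :=
  linking_vector k (between A (component p k)).

Definition d_count (k : 'I_n) (V : {set K n}) : nat :=
  #|` [fset X in single_component_letters k
        | letter_linking_vector k X \in V]%fset |.

Definition O_set (k : 'I_n) : {set {set K n}} :=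
  let l := component_linking_vector k in
  [set V in Kquot l :\ cls l 0%R | odd (d_count k V)].

Definition S_component (k : 'I_n) : K n * {set {set K n}} :=
  (component_linking_vector k, O_set k).

Definition S_invariant : n.-tuple (K n * {set {set K n}}) :=
  [tuple S_component k | k < n].

End Invariant.

(* Main.v *)
Require Import Defs.
From Stdlib Require Import Relation_Operators.
From mathcomp Require Import all_boot all_order all_algebra.
From mathcomp Require Import finmap ring zify.

(* Let t(a) be the basis vector of K_n attached to the component of the other
   occurrence of a letter a. Letters occurring twice cancel mod 2, so the linking
   vector of a word of component k is the sum of t(a) over all its occurrences:
   it is a monoid morphism. Hence the linking vector of a letter X is, up to
   t(X), the sum over the two occurrences of X of the linking vectors of the
   prefixes preceding them; this quantity changes in an explicit way when two
   adjacent factors are swapped and does not change when a factor with zero total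
   is deleted, which settles the moves uniformly, whichever components are
   involved. In H2 the two deleted letters have equal linking vectors and cancel
   in d_k mod 2; in H1 the deleted letter has linking vector 0, and in a shift
   the moved letter has its linking vector translated by l_k. *)

Set Implicit Arguments.
Unset Strict Implicit.
Unset Printing Implicit Defensive.

Import GRing.Theory.

Local Open Scope ring_scope.

(** * Arithmetic modulo 2 and orbits of translations *)

Lemma F2_addrr (x : 'F_2) : x + x = 0.
Proof. by rewrite -mulr2n -mulr_natr pchar_Zp ?mulr0. Qed.

Lemma F2_natr (m : nat) : (m%:R : 'F_2) = (odd m)%:R.
Proof.
by rewrite -{1}(odd_double_half m) natrD -addnn natrD F2_addrr addr0.
Qed.

Lemma K_addrr n (v : K n) : v + v = 0.
Proof. by apply/rowP => i; rewrite !mxE F2_addrr. Qed.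

Lemma K_addKr n (u v : K n) : u + (u + v) = v.
Proof. by rewrite addrA K_addrr add0r. Qed.

Lemma cls_shift n (u x : K n) V : V \in Kquot u -> (u + x \in V) = (x \in V).
Proof.
case/imsetP=> v _ ->; rewrite clsE !inE (can_eq (K_addKr u)) orbC; congr (_ || _).
by rewrite -{1}(K_addKr u v) (can_eq (K_addKr u)).
Qed.

(** Orbits are determined by any of their elements; hence excluding the class of 0 amounts to
    requiring [0 \notin V]. *)
Lemma cls_mem0 n (u : K n) V : V \in Kquot u -> 0 \in V -> V = cls u 0.
Proof.
case/imsetP=> v _ ->; rewrite !clsE addr0 !inE => /orP[] /eqP v0.
  by rewrite -v0 addr0.
by rewrite -(K_addKr u v) -v0 addr0 K_addrr setUC.
Qed.

(** * Phrases as sequences of located letters *)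

(* An occurrence of the letter a in the i-th component is encoded as (a, i). *)
Section Occurrences.
Variable T : choiceType.
Implicit Types (s : seq (seq T)) (w : seq (option T)) (i : nat).

(** H1, H2 and H3 cut the sequence with separators, whereas shifts and linking vectors refer to the
    list of components. [unbar] and [occurrences] read the same located letters off these two
    forms. *)
Fixpoint occurrences i s : seq (T * nat) :=
  if s is x :: s' then [seq (a, i) | a <- x] ++ occurrences i.+1 s' else [::].

Fixpoint unbar i w : seq (T * nat) :=
  if w is o :: w' then
    if o is Some a then (a, i) :: unbar i w' else unbar i.+1 w'
  else [::].

Lemma unbar_cat i w1 w2 :
  unbar i (w1 ++ w2) = unbar i w1 ++ unbar (i + count_mem None w1)%N w2.
Proof.
elim: w1 i => [|[a|] w1 IH] i //=; first by rewrite addn0.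
  by rewrite IH.
by rewrite IH add1n addnS addSn.
Qed.

Lemma unbar_barred s : unbar 0 (barred s) = occurrences 0 s.
Proof.
have unbar_Some i x w :
    unbar i (map Some x ++ w) = [seq (a, i) | a <- x] ++ unbar i w.
  by elim: x => //= a x ->.
case: s => [|x s] //=; rewrite unbar_Some; congr (_ ++ _).
by elim: s 0%N => //= y s IH i; rewrite unbar_Some IH.
Qed.

Lemma occurrences_cat i s1 s2 :
  occurrences i (s1 ++ s2) = occurrences i s1 ++ occurrences (i + size s1)%N s2.
Proof.
elim: s1 i => [|x s1 IH] i /=; first by rewrite addn0.
by rewrite IH catA addSnnS.
Qed.

Lemma occurrences_letters i s : map fst (occurrences i s) = flatten s.
Proof.
elim: s i => //= x s IH i; rewrite map_cat IH -map_comp.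
by rewrite (eq_map (_ : _ =1 id)) // map_id.
Qed.

Lemma occurrences_bounds i s x :
  x \in occurrences i s -> (i <= x.2 < i + size s)%N.
Proof.
elim: s i => //= y s IH i; rewrite mem_cat => /orP[/mapP[a _ ->] /=|/IH].
  by rewrite leqnn addnS leq_addr.
by rewrite addSnnS => /andP[/ltnW -> ->].
Qed.

Lemma occurrences_map (f : T -> T) i s :
  occurrences i (map (map f) s) = [seq (f x.1, x.2) | x <- occurrences i s].
Proof. by elim: s i => //= x s IH i; rewrite map_cat IH -!map_comp. Qed.

Lemma occurrences_filter i j s :
  [seq x <- occurrences i s | x.2 == i + j]%N =
  [seq (a, i + j)%N | a <- nth [::] s j].
Proof.
elim: s i j => [|x s IH] i [|j] //=; rewrite filter_cat filter_map.
  rewrite addn0 (eq_filter (_ : _ =1 predT)) ?filter_predT; last first.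
    by move=> a /=; rewrite eqxx.
  (* The later components carry indices greater than [i], so nothing of them survives the filter. *)
  rewrite (_ : filter _ (occurrences _ _) = [::]) ?cats0 //.
  apply/eqP; rewrite -size_eq0 size_filter -leqn0 leqNgt -has_count.
  by apply/hasPn=> y /occurrences_bounds /andP[/gtn_eqF ->].
rewrite -addSnnS IH (eq_filter (_ : _ =1 pred0)) ?filter_pred0 //.
by move=> a /=; apply/negbTE; rewrite neq_ltn addSn ltnS leq_addr.
Qed.

End Occurrences.

(** * Weights under concatenation, swaps and deletions *)

Section Weights.
Variables (T : choiceType) (n : nat).
Implicit Types (W u v a b : seq (T * nat)) (c : T -> K n) (k : 'I_n) (X : T).

(** If [X] occurs twice, in components i and j, this is the sum of the basis vectors e_i and e_j
    modulo 2, hence 0 when i = j. *)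
Definition incidence W X : K n := \row_i (count_mem (X, val i) W)%:R.

(* For c = incidence W, the weight of an occurrence in component k is the basis
   vector of the component of the other occurrence of the same letter. *)
Definition weight c k (x : T * nat) : K n :=
  if x.2 == val k then c x.1 + delta_mx 0 k else 0.

Definition total c k u : K n := \sum_(x <- u) weight c k x.

(* Sum, over the occurrences of X in component k, of the total weight of what
   precedes them. Since weights are 2-torsion, this is the total weight of the
   word between the two occurrences, up to the weight of X itself; unlike the
   word between, it behaves well under concatenation. *)
Fixpoint before c k X u : K n :=
  if u is x :: u' then weight c k x *+ count_mem (X, val k) u' + before c k X u'
  else 0.

Lemma total_cat c k u v : total c k (u ++ v) = total c k u + total c k v.
Proof. exact: big_cat. Qed.

Lemma total_cons c k x u : total c k (x :: u) = weight c k x + total c k u.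
Proof. exact: big_cons. Qed.

Lemma total_nil c k : total c k [::] = 0.
Proof. exact: big_nil. Qed.

Lemma before_cat c k X u v :
  before c k X (u ++ v) =
  before c k X u + total c k u *+ count_mem (X, val k) v + before c k X v.
Proof.
elim: u => [|x u IH] /=; first by rewrite total_nil mul0rn !add0r.
rewrite IH total_cons count_cat mulrnDr mulrnDl !addrA; congr (_ + _).
by rewrite -!addrA; congr (_ + _); rewrite addrCA.
Qed.

Lemma before_notin c k X u : count_mem (X, val k) u = 0%N -> before c k X u = 0.
Proof.
elim: u => [|x u IH] //= /eqP; rewrite addn_eq0 => /andP[_ /eqP u0].
by rewrite u0 IH // addr0.
Qed.

(** Only the relative order of [a] and [b] changes: the contribution of [a] as a prefix of [b] is
    lost and that of [b] as a prefix of [a] is gained. Modulo 2 a loss is a gain. *)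
Lemma before_swap c k X u a b v :
  before c k X (u ++ b ++ a ++ v) =
  before c k X (u ++ a ++ b ++ v) +
  (total c k a *+ count_mem (X, val k) b + total c k b *+ count_mem (X, val k) a).
Proof.
rewrite !before_cat !count_cat !mulrnDr.
set A := before _ _ _ a; set B := before _ _ _ b; set U := before _ _ _ u.
set V := before _ _ _ v; set ta := total _ _ a; set tb := total _ _ b.
set tu := total _ _ u.
set na := count_mem _ a; set nb := count_mem _ b; set nv := count_mem _ v.
apply/rowP => i; rewrite -!scaler_nat !mxE.
have := F2_addrr (nb%:R * ta 0 i).
move=> E; ring: E.
Qed.

(** The factor [a] adds nothing to the prefixes of later occurrences of [X], and holds no occurrence
    of [X] whose own prefix would count. *)
Lemma before_delete c k X u a v :
    total c k a = 0 -> count_mem (X, val k) a = 0%N ->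
  before c k X (u ++ a ++ v) = before c k X (u ++ v).
Proof.
move=> a0 Xa; rewrite !before_cat count_cat Xa a0 mul0rn addr0.
by rewrite (before_notin c Xa) add0r.
Qed.

Lemma total_perm c k u v : perm_eq u v -> total c k u = total c k v.
Proof. exact: perm_big. Qed.

Lemma incidence_perm u v : perm_eq u v -> incidence u =1 incidence v.
Proof. by move=> /permP uv X; apply/rowP => i; rewrite !mxE uv. Qed.

Lemma eq_in_weight c c' k x : c x.1 = c' x.1 -> weight c k x = weight c' k x.
Proof. by rewrite /weight => ->. Qed.

Lemma eq_in_total c c' k u :
  {in map fst u, c =1 c'} -> total c k u = total c' k u.
Proof.
move=> cc'; apply: eq_big_seq => x xu; apply/eq_in_weight/cc'.
exact: map_f.
Qed.

Lemma eq_in_before c c' k X u :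
  {in map fst u, c =1 c'} -> before c k X u = before c' k X u.
Proof.
elim: u => //= x u IH cc'; rewrite IH; last first.
  by move=> y yu; apply: cc'; rewrite inE yu orbT.
by rewrite (eq_in_weight _ (cc' _ (mem_head _ _))).
Qed.

Lemma total_out c k u :
  {in u, forall x, x.2 != val k} -> total c k u = 0.
Proof.
by move=> uk; apply: big1_seq => x /andP[_ /uk/negPf xk]; rewrite /weight xk.
Qed.

Lemma count_pair (m : nat) X (s : seq T) :
  count_mem (X, m) [seq (x, m) | x <- s] = count_mem X s.
Proof.
rewrite count_map; apply: eq_count => x /=.
by rewrite xpair_eqE eqxx andbT.
Qed.

Lemma total_filter c k u : total c k [seq x <- u | x.2 == val k] = total c k u.
Proof.
rewrite /total big_filter big_mkcond; apply: eq_bigr => x _.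
by rewrite /weight; case: (x.2 == val k).
Qed.

Lemma count_mem_filter k X u :
  count_mem (X, val k) [seq x <- u | x.2 == val k] = count_mem (X, val k) u.
Proof.
rewrite count_filter; apply: eq_count => x /=; apply: andb_idr => /eqP -> /=.
exact: eqxx.
Qed.

(** Letters outside component [k] have weight 0 and are never counted as [X], so [before] may be
    computed on the whole phrase. *)
Lemma before_filter c k X u :
  before c k X [seq x <- u | x.2 == val k] = before c k X u.
Proof.
elim: u => //= x u IH; rewrite /weight; case: ifP => /= xk.
  by rewrite /weight xk IH count_mem_filter.
by rewrite mul0rn add0r.
Qed.

End Weights.

(** * Linking vectors expressed through weights *)

Lemma count2_split (T : eqType) (a : T) (s : seq T) :
  count_mem a s = 2%N -> exists x y z, s = x ++ a :: y ++ a :: z.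
Proof.
elim: s => //= b s IH; case: eqVneq => [->|ba].
  rewrite add1n => -[a1]; have /splitPr[y z] : a \in s.
    by rewrite -has_pred1 has_count a1.
  by exists [::], y, z.
by rewrite add0n => /IH[x [y [z ->]]]; exists (b :: x), y, z.
Qed.

Section Phrase.
Variables (T : choiceType) (n : nat) (p : gauss_phrase T n).
Implicit Types (k : 'I_n) (X : T).

Definition occ : seq (T * nat) := unbar 0 (barred (comps p)).

Lemma occE : occ = occurrences 0 (comps p).
Proof. exact: unbar_barred. Qed.

Lemma occ_filter k :
  [seq x <- occ | x.2 == val k] = [seq (a, val k) | a <- component p k].
Proof.
by rewrite occE -[val k]add0n occurrences_filter /component (tnth_nth [::]).
Qed.

Lemma count_occ k X : count_mem (X, val k) occ = count_mem X (component p k).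
Proof.
by rewrite -count_mem_filter occ_filter count_pair.
Qed.

Lemma mem_alphabet X : (X \in alphabet p) = (X \in map fst occ).
Proof.
rewrite occE occurrences_letters; have [sub two] := comps_gauss p.
apply/idP/idP => [/two c2|/sub //]; by rewrite -has_pred1 has_count c2.
Qed.

Lemma count_letter X : X \in alphabet p -> count (fun x => x.1 == X) occ = 2%N.
Proof.
have [_ two] := comps_gauss p; move=> /two <-.
by rewrite -(occurrences_letters 0) -occE count_map.
Qed.

Lemma mem_component k X : X \in component p k -> X \in alphabet p.
Proof.
rewrite mem_alphabet -has_pred1 has_count -count_occ -has_count has_pred1.
by move=> /(map_f fst).
Qed.

Lemma count_component_le2 k X : (count_mem X (component p k) <= 2)%N.
Proof.
have [Xk|Xk] := boolP (X \in component p k); last by rewrite (count_memPn Xk).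
rewrite -(count_letter (mem_component Xk)) -count_occ.
by apply: sub_count => x /= /eqP ->.
Qed.

Lemma count_components_le2 k i X : i != k ->
  (count_mem X (component p k) + count_mem X (component p i) <= 2)%N.
Proof.
move=> ik; have [Xk|Xk] := boolP (X \in component p k); last first.
  by rewrite (count_memPn Xk) count_component_le2.
rewrite -(count_letter (mem_component Xk)) -!count_occ -count_predUI.
rewrite (@eq_count _ (predI _ _) pred0) ?count_pred0 ?addn0; last first.
  move=> x /=; apply/negbTE/negP=> /andP[/eqP -> /eqP[/esym /eqP]].
  by rewrite val_eqE (negPf ik).
by apply: sub_count => x /= /orP[] /eqP ->.
Qed.

Notation c := (incidence n occ).

(** One occurrence in component [k] is discounted, leaving the other one. At [i = k] the count is 1
    or 2 and the basis vector flips its parity; elsewhere it is 0 or 1, and its parity is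
    membership. *)
Lemma incidence_entry k i X : X \in component p k ->
  (c X + delta_mx 0 k) 0 i =
  (if i == k then count_mem X (component p k) == 2%N
   else X \in component p i)%:R.
Proof.
move=> Xk; rewrite !mxE eqxx /= count_occ F2_natr.
have := count_component_le2 k X; have: (0 < count_mem X (component p k))%N.
  by rewrite -has_count has_pred1.
case: eqVneq => [->|ik].
  by case: (count_mem _ _) => [|[|[]]] // _ _; [apply: F2_addrr | apply: add0r].
have := count_components_le2 X ik; rewrite addr0 -has_pred1 has_count.
by case: (count_mem X (component p k)) => [|[|[]]] //;
  case: (count_mem X (component p i)) => [|[|[]]].
Qed.

Lemma linking_vectorE k (w : seq T) :
    {subset w <= component p k} -> (forall a, count_mem a w <= 2)%N ->
  linking_vector p k w = \sum_(a <- w) (c a + delta_mx 0 k).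
Proof.
move=> wk w2; apply/rowP => i; rewrite mxE summxE.
pose Q a := if i == k then count_mem a (component p k) == 2%N
            else a \in component p i.
rewrite (eq_big_seq (fun a => (Q a)%:R)) => [|a /wk]; last exact: incidence_entry.
(* The sum is grouped by distinct letters: those occurring twice in [w] cancel, and those occurring
   once are the letters counted by the linking vector. *)
rewrite -big_undup_iterop_count /=.
rewrite (perm_size (_ : perm_eq _ [seq a <- undup w | (count_mem a w == 1%N) && Q a])).
  rewrite size_filter -sum1_count natr_sum big_mkcond /=.
  apply: eq_big_seq => a; rewrite mem_undup => aw.
  rewrite -/(_ *+ _); have := w2 a; have: (0 < count_mem a w)%N.
    by rewrite -has_count has_pred1.
  by case: (count_mem _ _) => [|[|[]]] // _ _; rewrite ?mulr2n ?F2_addrr; case: (Q a).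
apply: uniq_perm; rewrite ?filter_uniq ?undup_uniq ?fset_uniq // => a.
rewrite !inE /= mem_filter mem_undup.
apply/andP/andP => [[_ /andP[a1 Qa]]|[/andP[-> Qa] aw]].
  by rewrite a1; split=> //; rewrite -has_pred1 has_count (eqP a1).
by split=> //; apply/mem_component/wk.
Qed.

Lemma component_linking_vectorE k : component_linking_vector p k = total c k occ.
Proof.
rewrite /component_linking_vector linking_vectorE //; last exact: count_component_le2.
rewrite -total_filter occ_filter /total big_map; apply: eq_bigr => a _.
by rewrite /weight eqxx.
Qed.

(** In [x ++ X :: y ++ X :: z] the word [x] precedes both occurrences and cancels. The prefix of the
    second one also contains the first [X], whose weight is cancelled by the added basis vector; the
    total of [y] remains. *)
Lemma letter_linking_vectorE k X : count_mem X (component p k) = 2%N ->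
  letter_linking_vector p k X = delta_mx 0 k + before c k X occ.
Proof.
move=> X2.
have Xk : X \in component p k by rewrite -has_pred1 has_count X2.
have cX : c X + delta_mx 0 k = delta_mx 0 k.
  apply/rowP => i; rewrite incidence_entry // !mxE X2 eqxx /=.
  case: eqVneq => // ik; case: (boolP (X \in _)) => //.
  rewrite -has_pred1 has_count; have := count_components_le2 X ik.
  by rewrite X2; case: count.
have [x [y [z E]]] := count2_split X2.
have [x0 y0 z0] : [/\ count_mem X x = 0, count_mem X y = 0 & count_mem X z = 0]%N.
  by move: X2; rewrite E count_cat /= count_cat /= eqxx => X2; split; lia.
rewrite /letter_linking_vector E betweenE -?E // linking_vectorE; last 2 first.
- by move=> a ay; rewrite E mem_cat inE mem_cat ay !orbT.
- move=> a; apply: leq_trans (count_component_le2 k a).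
  by rewrite E count_cat /= count_cat /=; lia.
rewrite -before_filter occ_filter E.
rewrite map_cat map_cons map_cat map_cons before_cat /= before_cat /=.
rewrite !before_notin ?count_cat /= ?count_cat /= ?count_pair ?x0 ?y0 ?z0 // !eqxx.
rewrite !addn0 !add0n mulr2n K_addrr mulr1n mulr0n !add0r addr0.
rewrite /weight eqxx cX mulr1n K_addKr /total big_map.
by apply: eq_bigr => a _; rewrite /weight eqxx.
Qed.

End Phrase.

(** * Criteria for the equality of invariants *)

Section Invariance.
Variables (T : choiceType) (n : nat).
Implicit Types (p q : gauss_phrase T n) (W u v : seq (T * nat)) (k : 'I_n).

Definition linking_in W k (V : {set K n}) (X : T) : bool :=
  (count_mem (X, val k) W == 2%N) &&
  (delta_mx 0 k + before (incidence n W) k X W \in V).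

(** The free choice of the enumeration [s] allows deleted letters to be listed ahead of the
    remaining alphabet. *)
Lemma d_countE p k V (s : seq T) : uniq s -> alphabet p =i s ->
  d_count p k V = count (linking_in (occ p) k V) s.
Proof.
move=> s_uniq ps; rewrite -size_filter; apply/perm_size/uniq_perm.
- exact: fset_uniq.
- exact: filter_uniq.
move=> X; rewrite mem_filter -ps !inE /= /linking_in count_occ.
rewrite [RHS]andbC -[LHS]andbA; congr (_ && _).
by case: eqP => //= X2; rewrite letter_linking_vectorE.
Qed.

Lemma S_invariant_eq p q :
    (forall k, total (incidence n (occ p)) k (occ p) =
               total (incidence n (occ q)) k (occ q)) ->
    (forall k V, V \in Kquot (total (incidence n (occ p)) k (occ p)) ->
       0 \notin V -> odd (d_count p k V) = odd (d_count q k V)) ->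
  S_invariant p = S_invariant q.
Proof.
move=> pq_total pq_odd; apply/eq_from_tnth => k; rewrite !tnth_mktuple.
rewrite /S_component /O_set !component_linking_vectorE -pq_total; congr pair.
apply/setP => V; rewrite !inE; case: eqVneq => //= V0.
case: (boolP (V \in _)) => //= VK; apply: pq_odd => //.
by apply: contra V0 => /(cls_mem0 VK) ->.
Qed.

(** Criterion for shifts and H3, which only reorder occurrences: incidences, totals and alphabets
    agree, so a letterwise comparison suffices. *)
Lemma S_invariant_perm p q :
    perm_eq (occ p) (occ q) ->
    (forall k V X, V \in Kquot (total (incidence n (occ p)) k (occ p)) ->
       X \in alphabet p -> linking_in (occ p) k V X = linking_in (occ q) k V X) ->
  S_invariant p = S_invariant q.
Proof.
move=> pq lk_pq; apply: S_invariant_eq => [k|k V VK _].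
  rewrite (total_perm _ _ pq); apply: eq_in_total => X _.
  exact: incidence_perm.
rewrite !(@d_countE _ _ _ (alphabet p)) ?fset_uniq //.
  by congr (odd _); apply: eq_in_count => X; apply: lk_pq.
by move=> X; rewrite [X \in enum_fset _]mem_alphabet mem_alphabet;
  apply/esym/perm_mem/perm_map.
Qed.

Lemma mem_letters X u : (X \in map fst u) = (0 < count (fun x => x.1 == X) u)%N.
Proof. by rewrite -has_pred1 has_map has_count. Qed.

Lemma count_letter_ge (m : nat) X u :
  (count_mem (X, m) u <= count (fun x => x.1 == X) u)%N.
Proof. by apply: sub_count => x /= /eqP ->. Qed.

(** * Isomorphisms and shift moves *)

Lemma isomorphic_S p q : isomorphic p q -> S_invariant p = S_invariant q.
Proof.
case=> f [f_inj _ /(congr1 val) /= pq].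
have Wq : occ q = [seq (f x.1, x.2) | x <- occ p].
  by rewrite !occE -pq occurrences_map.
have f_injW : {in map fst (occ p) &, injective f}.
  by move=> a b; rewrite -!mem_alphabet; apply: f_inj.
have count_f X (m : nat) u : {subset map fst u <= map fst (occ p)} ->
    X \in map fst (occ p) ->
    count_mem (f X, m) [seq (f x.1, x.2) | x <- u] = count_mem (X, m) u.
  move=> uW XW; rewrite count_map; apply: eq_in_count => x xu /=.
  rewrite !xpair_eqE; congr (_ && _); apply/eqP/eqP => [|->] //.
  by apply: f_injW => //; apply/uW/map_f.
have inc_f X : X \in map fst (occ p) ->
    incidence n (occ q) (f X) = incidence n (occ p) X.
  by move=> XW; apply/rowP => i; rewrite !mxE Wq count_f.
have weight_f k x : x.1 \in map fst (occ p) ->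
    weight (incidence n (occ q)) k (f x.1, x.2) = weight (incidence n (occ p)) k x.
  by move=> xW; rewrite /weight /= inc_f.
have before_f k X u : {subset map fst u <= map fst (occ p)} ->
    X \in map fst (occ p) ->
    before (incidence n (occ q)) k (f X) [seq (f x.1, x.2) | x <- u] =
    before (incidence n (occ p)) k X u.
  move=> + XW; elim: u => //= x u IH xuW.
  have uW : {subset map fst u <= map fst (occ p)}.
    by move=> a au; apply: xuW; rewrite inE au orbT.
  by rewrite IH // count_f // weight_f //; apply/xuW/mem_head.
apply: S_invariant_eq => [k|k V _ _].
  rewrite [in X in _ = total _ _ X]Wq /total big_map; apply: eq_big_seq => x xW.
  by rewrite weight_f //; apply: map_f.
rewrite (@d_countE _ _ _ (undup (map fst (occ p)))) ?undup_uniq //; last first.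
  by move=> X; rewrite mem_undup mem_alphabet.
rewrite (@d_countE _ _ _ (map f (undup (map fst (occ p))))); last first.
- move=> X; rewrite mem_alphabet Wq.
  have -> : map fst [seq (f x.1, x.2) | x <- occ p] = map f (map fst (occ p)).
    by rewrite -!map_comp.
  by apply/eq_mem_map => Y; rewrite mem_undup.
- rewrite map_inj_in_uniq ?undup_uniq // => a b; rewrite !mem_undup.
  exact: f_injW.
rewrite count_map; congr (odd _); apply: eq_in_count => X; rewrite mem_undup => XW.
by rewrite /linking_in /= -before_f // -(count_f X k (occ p)) // -Wq.
Qed.

Lemma shift_S p q : shift_move p q -> S_invariant p = S_invariant q.
Proof.
case=> k0 [A [y [pk qk pq]]].
pose u := occurrences 0 (take k0 (comps p)).
pose v := occurrences k0.+1 (drop k0.+1 (comps p)).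
have split_occ r : take k0 (comps r) = take k0 (comps p) ->
    drop k0.+1 (comps r) = drop k0.+1 (comps p) ->
    occ r = u ++ [seq (a, val k0) | a <- component r k0] ++ v.
  move=> tr dr; rewrite occE -(cat_take_drop k0 (comps r)) tr.
  have k0r : (k0 < size (comps r))%N by rewrite size_tuple.
  rewrite (drop_nth [::]) // dr occurrences_cat size_takel; last first.
    by rewrite size_tuple ltnW.
  by rewrite add0n /component (tnth_nth [::]).
have nth_pq (m : nat) : m != val k0 -> nth [::] (comps q) m = nth [::] (comps p) m.
  (* Past the last component both sides are the default empty word. *)
  move=> mk0; case: (ltnP m n) => mn; last by rewrite !nth_default ?size_tuple.
  have := pq (Ordinal mn); rewrite /component !(tnth_nth [::]); apply.
  exact: mk0.
have Wp : occ p = u ++ [:: (A, val k0)] ++ [seq (a, val k0) | a <- y] ++ v.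
  by rewrite (split_occ p) // pk.
have Wq : occ q = u ++ [seq (a, val k0) | a <- y] ++ [:: (A, val k0)] ++ v.
  rewrite (split_occ q) ?qk ?map_rcons -?cats1 -?catA //.
    apply: (@eq_from_nth _ [::]); first by rewrite !size_take !size_tuple.
    move=> m; rewrite size_takel ?size_tuple ?(ltnW (ltn_ord k0)) // => mk0.
    by rewrite !nth_take // nth_pq // ltn_eqF.
  apply: (@eq_from_nth _ [::]); first by rewrite !size_drop !size_tuple.
  by move=> m _; rewrite !nth_drop nth_pq // gtn_eqF // leq_addr.
have pq_perm : perm_eq (occ p) (occ q).
  by rewrite Wp Wq perm_cat2l perm_catCA.
have u_k0 x : x \in u -> x.2 != k0.
  move=> /occurrences_bounds; rewrite add0n size_takel ?size_tuple
    ?(ltnW (ltn_ord k0)) //.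
  by move=> /andP[_ xk0]; rewrite ltn_eqF.
have v_k0 x : x \in v -> x.2 != k0.
  by move=> /occurrences_bounds /andP[xk0 _]; rewrite gtn_eqF.
apply: S_invariant_perm => // k V X VK Xp.
rewrite /linking_in (permP pq_perm); case: eqP => //= X2.
rewrite (@eq_in_before _ _ (incidence n (occ q)) (incidence n (occ p))); last first.
  by move=> a _; apply/esym/incidence_perm.
(* A shift swaps the adjacent factors [A] and [y], so only the correction term of [before_swap] has
   to be controlled. *)
rewrite [in RHS]Wq before_swap -Wp.
have [k0k|k0k] := eqVneq k0 k; last first.
  by rewrite !total_out ?mul0rn ?addr0 // => x;
    [case/mapP=> a _ -> | rewrite inE => /eqP ->].
subst k; move: X2; rewrite count_occ qk -cats1 count_cat /= addn0 count_pair => X2.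
(* If [X] is not [A], it occurs twice in [y] and the correction is twice the weight of [A], that is
   0. *)
rewrite xpair_eqE eqxx andbT; case: (A == X) X2 => /=; last first.
  by rewrite !addn0 => ->; rewrite mulr2n K_addrr !addr0.
(* If [X] is [A], the correction is the total of the whole component, and [V] is stable under
   translation by it. *)
rewrite !addn1 => -[->]; rewrite !mulr1n addrA -total_cat.
rewrite -[in LHS](cls_shift _ VK) addrC; congr (_ + _ \in V).
rewrite [X in total _ _ X]Wp !total_cat (total_out _ u_k0) (total_out _ v_k0).
by rewrite add0r addr0.
Qed.

(** * Deletion of one letter or of two letters *)

Lemma S_invariant_delete1 p q A (i : nat) x y :
    occ p = x ++ [:: (A, i); (A, i)] ++ y -> occ q = x ++ y ->
  S_invariant p = S_invariant q.
Proof.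
move=> Wp Wq; have Ap : A \in alphabet p.
  by rewrite mem_alphabet Wp map_cat mem_cat mem_head orbT.
have A2 := count_letter Ap; rewrite Wp !count_cat /= eqxx in A2.
have Aq : A \notin alphabet q.
  rewrite mem_alphabet Wq mem_letters count_cat.
  rewrite /=; lia.
have countA (m : nat) : count_mem (A, m) (occ p) = ((i == m) + (i == m))%N.
  have := count_letter_ge m A x; have := count_letter_ge m A y.
  by rewrite Wp !count_cat /= !xpair_eqE eqxx /=; lia.
have incA : incidence n (occ p) A = 0.
  by apply/rowP => m; rewrite !mxE countA addnn F2_natr odd_double.
have count_pq X (m : nat) : X != A ->
    count_mem (X, m) (occ p) = count_mem (X, m) (occ q).
  move=> XA; rewrite Wp Wq !count_cat /= !xpair_eqE eq_sym (negPf XA) /=; lia.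
have inc_pq : {in map fst (occ q), incidence n (occ p) =1 incidence n (occ q)}.
  move=> X Xq; apply/rowP => m; rewrite !mxE count_pq //.
  by apply: contraNneq Aq => <-; rewrite mem_alphabet.
have totalA k : total (incidence n (occ p)) k [:: (A, i); (A, i)] = 0.
  by rewrite !total_cons total_nil addr0 K_addrr.
apply: S_invariant_eq => [k|k V VK V0].
  rewrite -(eq_in_total _ inc_pq) [X in total _ _ X = _]Wp total_cat total_cat totalA.
  by rewrite add0r -total_cat -Wq.
have Aqs : A \notin (alphabet q : seq T) by [].
rewrite (@d_countE q _ _ (alphabet q)) ?fset_uniq //.
rewrite (@d_countE p _ _ (A :: alphabet q)); last first.
- move=> X; rewrite inE [X \in enum_fset _]mem_alphabet mem_alphabet Wp Wq !map_cat.
  by rewrite !mem_cat !inE; case: (X == A); rewrite /= ?orbT ?orbF.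
- by rewrite /= Aqs fset_uniq.
(* Nothing lies between the two occurrences of [A], so its linking vector is 0, which [V] does not
   contain. *)
rewrite /=; have -> : linking_in (occ p) k V A = false.
  rewrite /linking_in countA; case: eqP => //= ik.
  apply: contraNF V0; rewrite [X in before _ _ _ X]Wp !before_cat /=.
  have /= Ax := count_letter_ge k A x; have /= Ay := count_letter_ge k A y.
  have Ay0 : count_mem (A, val k) y = 0%N by rewrite /=; lia.
  have Ax0 : count_mem (A, val k) x = 0%N by rewrite /=; lia.
  have ik1 : i = val k by rewrite /=; lia.
  rewrite !before_notin // totalA mul0rn [count_mem _ y]Ay0 ik1 !eqxx !addn0.
  rewrite -[(true + true)%N]/2%N mulr2n K_addrr mulr1n mulr0n !addr0 add0r.
  by rewrite /weight /= eqxx incA add0r K_addrr.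
congr (odd _); apply: eq_in_count => X Xq.
have XA : X != A by apply: contraNneq Aqs => <-.
rewrite /linking_in count_pq //; congr (_ && (_ + _ \in V)).
rewrite -(eq_in_before _ _ inc_pq) [X in before _ _ _ X = _]Wp before_delete //.
  by rewrite -Wq.
by rewrite /= !xpair_eqE eq_sym (negPf XA).
Qed.

Lemma S_invariant_delete2 p q A B (i j : nat) x y z : A != B ->
    occ p = x ++ [:: (A, i); (B, i)] ++ y ++ [:: (B, j); (A, j)] ++ z ->
    occ q = x ++ y ++ z ->
  S_invariant p = S_invariant q.
Proof.
move=> AB Wp Wq; have BA : (B == A) = false by rewrite eq_sym (negPf AB).
have Ap : A \in alphabet p.
  by rewrite mem_alphabet Wp map_cat mem_cat mem_head orbT.
have Bp : B \in alphabet p.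
  by rewrite mem_alphabet Wp map_cat mem_cat !inE eqxx !orbT.
have A2 := count_letter Ap; have B2 := count_letter Bp.
rewrite Wp !count_cat /= !eqxx BA /= in A2.
rewrite Wp !count_cat /= !eqxx (negPf AB) /= in B2.
have Aq : A \notin alphabet q.
  rewrite mem_alphabet Wq mem_letters !count_cat /=; lia.
have Bq : B \notin alphabet q.
  rewrite mem_alphabet Wq mem_letters !count_cat /=; lia.
have count_pq X (m : nat) : X != A -> X != B ->
    count_mem (X, m) (occ p) = count_mem (X, m) (occ q).
  move=> XA XB; rewrite Wp Wq !count_cat /= !xpair_eqE.
  rewrite ![_ == X]eq_sym (negPf XA) (negPf XB) /=; lia.
have inc_pq : {in map fst (occ q), incidence n (occ p) =1 incidence n (occ q)}.
  move=> X; rewrite -mem_alphabet => Xq; apply/rowP => m; rewrite !mxE count_pq //.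
    by apply: contraNneq Aq => <-.
  by apply: contraNneq Bq => <-.
have countA (m : nat) : count_mem (A, m) (occ p) = ((i == m) + (j == m))%N.
  have := count_letter_ge m A x; have := count_letter_ge m A y.
  have := count_letter_ge m A z.
  by rewrite Wp !count_cat /= !xpair_eqE eqxx BA /=; lia.
have countB (m : nat) : count_mem (B, m) (occ p) = ((i == m) + (j == m))%N.
  have := count_letter_ge m B x; have := count_letter_ge m B y.
  have := count_letter_ge m B z.
  by rewrite Wp !count_cat /= !xpair_eqE eqxx (negPf AB) /=; lia.
set c := incidence n (occ p).
(* [A] and [B] both occur in components [i] and [j], equal or not; so each deleted pair has total
   weight 0. *)
have cAB : c A = c B by apply/rowP => m; rewrite !mxE countA countB.
have weightAB k (m : nat) : weight c k (A, m) = weight c k (B, m).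
  by rewrite /weight /= cAB.
have totalAB k (m : nat) : total c k [:: (A, m); (B, m)] = 0.
  by rewrite !total_cons total_nil weightAB addr0 K_addrr.
have totalBA k (m : nat) : total c k [:: (B, m); (A, m)] = 0.
  by rewrite !total_cons total_nil weightAB addr0 K_addrr.
apply: S_invariant_eq => [k|k V VK V0].
  rewrite -(eq_in_total _ inc_pq) -/c Wp Wq !total_cat totalAB totalBA.
  by rewrite !add0r.
rewrite (@d_countE q _ _ (alphabet q)) ?fset_uniq //.
rewrite (@d_countE p _ _ (A :: B :: alphabet q)); last first.
- move=> X; rewrite !inE [X \in enum_fset _]mem_alphabet mem_alphabet Wp Wq !map_cat.
  rewrite !mem_cat !inE.
  by case: (X == A); case: (X == B); rewrite ?orbT //= ?orbF.
- by rewrite /= inE (negPf AB) Aq Bq fset_uniq.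
(* Within the pairs, one occurrence of [A] follows a [B] and one occurrence of [B] follows an [A],
   with equal weights. The other contributions are the same for both letters. *)
rewrite /=; have -> : linking_in (occ p) k V A = linking_in (occ p) k V B.
  rewrite /linking_in countA countB; case: eqP => //= ijk.
  have [ik jk] : i = val k /\ j = val k by split=> /=; lia.
  have /= Ax := count_letter_ge k A x; have /= Ay := count_letter_ge k A y.
  have /= Az := count_letter_ge k A z; have /= Bx := count_letter_ge k B x.
  have /= By := count_letter_ge k B y; have /= Bz := count_letter_ge k B z.
  rewrite -/c Wp !before_cat !totalAB !totalBA !mul0rn.
  have Ax0 : count_mem (A, val k) x = 0%N by rewrite /=; lia.
  have Ay0 : count_mem (A, val k) y = 0%N by rewrite /=; lia.
  have Az0 : count_mem (A, val k) z = 0%N by rewrite /=; lia.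
  have Bx0 : count_mem (B, val k) x = 0%N by rewrite /=; lia.
  have By0 : count_mem (B, val k) y = 0%N by rewrite /=; lia.
  have Bz0 : count_mem (B, val k) z = 0%N by rewrite /=; lia.
  rewrite !(before_notin _ Ax0) !(before_notin _ Ay0) !(before_notin _ Az0).
  rewrite !(before_notin _ Bx0) !(before_notin _ By0) !(before_notin _ Bz0).
  rewrite !count_cat Ay0 Az0 By0 Bz0 /= !xpair_eqE !ik !jk !eqxx (negPf AB) BA /=.
  rewrite !(add0n, addn0, mulr0n, mulr1n, add0r, addr0) weightAB.
  by rewrite (addrC (weight _ _ _)).
rewrite addnA oddD addnn odd_double /=; congr (odd _).
apply: eq_in_count => X Xq.
have XA : X != A by apply: contraNneq Aq => <-.
have XB : X != B by apply: contraNneq Bq => <-.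
rewrite /linking_in count_pq //; congr (_ && (_ + _ \in V)).
rewrite -(eq_in_before _ _ inc_pq) -/c Wp Wq.
rewrite (before_delete _ _ (totalAB _ _)); last first.
  by rewrite /= !xpair_eqE ![_ == X]eq_sym (negPf XA) (negPf XB).
have := before_delete (X := X) (x ++ y) z (totalBA k j); rewrite -!catA; apply.
by rewrite /= !xpair_eqE ![_ == X]eq_sym (negPf XA) (negPf XB).
Qed.

(** * The triple swap and the remaining moves *)

(** Each of [A], [B], [C] is swapped once with each of the other two. If one of them is a
    single-component letter, the other two occur in the same pair of components, so its two
    corrections are equal weights and cancel. *)
Lemma S_invariant_swap3 p q A B C (i j l : nat) w x y z : uniq [:: A; B; C] ->
    occ p = w ++ [:: (A, i); (B, i)] ++ x ++ [:: (A, j); (C, j)] ++ y ++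
            [:: (B, l); (C, l)] ++ z ->
    occ q = w ++ [:: (B, i); (A, i)] ++ x ++ [:: (C, j); (A, j)] ++ y ++
            [:: (C, l); (B, l)] ++ z ->
  S_invariant p = S_invariant q.
Proof.
rewrite /= !inE !negb_or andbT => /andP[/andP[AB AC] BC] Wp Wq.
have [BA CA CB] : [/\ B != A, C != A & C != B].
  by rewrite ![_ == A]eq_sym [C == B]eq_sym.
have pq : perm_eq (occ p) (occ q).
  have swap (a b : T * nat) : perm_eq [:: a; b] [:: b; a].
    exact/permPl/(perm_catC [:: a] [:: b]).
  by rewrite Wp Wq; do 3!rewrite perm_cat2l (perm_catr _ (swap _ _)) perm_cat2l.
have [Ap Bp Cp] : [/\ A \in alphabet p, B \in alphabet p & C \in alphabet p].
  by split; rewrite mem_alphabet Wp mem_letters; do ![rewrite count_cat /=];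
    rewrite eqxx; lia.
have A2 := count_letter Ap; have B2 := count_letter Bp; have C2 := count_letter Cp.
rewrite Wp in A2; do ![rewrite count_cat /= in A2].
rewrite !eqxx (negPf BA) (negPf CA) /= in A2.
rewrite Wp in B2; do ![rewrite count_cat /= in B2].
rewrite !eqxx (negPf AB) (negPf CB) /= in B2.
rewrite Wp in C2; do ![rewrite count_cat /= in C2].
rewrite !eqxx (negPf AC) (negPf BC) /= in C2.
have countA (m : nat) : count_mem (A, m) (occ p) = ((i == m) + (j == m))%N.
  have := count_letter_ge m A w; have := count_letter_ge m A x.
  have := count_letter_ge m A y; have := count_letter_ge m A z.
  rewrite Wp; do ![rewrite count_cat /=].
  by rewrite !xpair_eqE !eqxx (negPf BA) (negPf CA) /=; lia.
have countB (m : nat) : count_mem (B, m) (occ p) = ((i == m) + (l == m))%N.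
  have := count_letter_ge m B w; have := count_letter_ge m B x.
  have := count_letter_ge m B y; have := count_letter_ge m B z.
  rewrite Wp; do ![rewrite count_cat /=].
  by rewrite !xpair_eqE !eqxx (negPf AB) (negPf CB) /=; lia.
have countC (m : nat) : count_mem (C, m) (occ p) = ((j == m) + (l == m))%N.
  have := count_letter_ge m C w; have := count_letter_ge m C x.
  have := count_letter_ge m C y; have := count_letter_ge m C z.
  rewrite Wp; do ![rewrite count_cat /=].
  by rewrite !xpair_eqE !eqxx (negPf AC) (negPf BC) /=; lia.
apply: S_invariant_perm => // k V X _ _.
rewrite /linking_in -(permP pq); case: eqP => //= X2; congr (_ + _ \in V).
rewrite -(eq_in_before _ _ (in1W (incidence_perm n pq))).
set c := incidence n (occ p).
(* The swaps are undone from left to right, the factors further right staying in the order they have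
   in [q]. *)
have swap1 := before_swap c k X w [:: (A, i)] [:: (B, i)]
  (x ++ [:: (C, j)] ++ [:: (A, j)] ++ y ++ [:: (C, l)] ++ [:: (B, l)] ++ z).
have swap2 := before_swap c k X (w ++ [:: (A, i); (B, i)] ++ x)
  [:: (A, j)] [:: (C, j)] (y ++ [:: (C, l)] ++ [:: (B, l)] ++ z).
have swap3 := before_swap c k X
  (w ++ [:: (A, i); (B, i)] ++ x ++ [:: (A, j); (C, j)] ++ y)
  [:: (B, l)] [:: (C, l)] z.
rewrite -!catA /= in swap1 swap2 swap3.
rewrite [X in _ = before _ _ _ X]Wq [X in before _ _ _ X = _]Wp /=.
rewrite swap1 swap2 swap3 -!addrA -[LHS]addr0; congr (_ + _).
rewrite !total_cons !total_nil !addr0 !addn0.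
rewrite !xpair_eqE.
have [XA|XA] := eqVneq X A.
  rewrite XA countA in X2; have ij : i = j by lia.
  have cBC : c B = c C by apply/rowP => h; rewrite !mxE countB countC ij.
  have weightBC m : weight c k (B, m) = weight c k (C, m).
    by rewrite /weight /= cBC.
  rewrite XA ij (negPf BA) (negPf CA) /= !mulr0n weightBC.
  by rewrite !add0r K_addrr.
have [XB|XB] := eqVneq X B.
  rewrite XB countB in X2; have il : i = l by lia.
  have cAC : c A = c C by apply/rowP => h; rewrite !mxE countA countC il addnC.
  have weightAC m : weight c k (A, m) = weight c k (C, m).
    by rewrite /weight /= cAC.
  rewrite XB il (negPf CB) /= !mulr0n weightAC.
  by rewrite !add0r addr0 K_addrr.
have [XC|XC] := eqVneq X C.
  rewrite XC countC in X2; have jl : j = l by lia.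
  have cAB : c A = c B by apply/rowP => h; rewrite !mxE countA countB jl.
  have weightAB m : weight c k (A, m) = weight c k (B, m).
    by rewrite /weight /= cAB.
  rewrite jl /= !mulr0n weightAB.
  by rewrite !addr0 add0r K_addrr.
by rewrite /= !mulr0n !addr0.
Qed.

(** Applying [unbar 0] turns the separators to the left of a displayed subword into the index shared
    by its two letters. *)
Lemma H1_S p q : H1 p q -> S_invariant p = S_invariant q.
Proof.
case=> A [x [y [/(congr1 (unbar 0)) Wp /(congr1 (unbar 0)) Wq]]].
rewrite !unbar_cat /= ?addn0 in Wp Wq; exact: S_invariant_delete1 Wp Wq.
Qed.

Lemma H2_S p q : H2 p q -> S_invariant p = S_invariant q.
Proof.
case=> A [B [x [y [z [AB /(congr1 (unbar 0)) Wp /(congr1 (unbar 0)) Wq]]]]].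
rewrite !unbar_cat /= ?addn0 in Wp Wq; exact: S_invariant_delete2 AB Wp Wq.
Qed.

Lemma H3_S p q : H3 p q -> S_invariant p = S_invariant q.
Proof.
case=> A [B [C [w [x [y [z [ABC]]]]]]].
move=> /(congr1 (unbar 0)) Wp /(congr1 (unbar 0)) Wq.
rewrite !unbar_cat /= ?addn0 in Wp Wq; exact: S_invariant_swap3 ABC Wp Wq.
Qed.

End Invariance.

Theorem theorem6p2 (T : choiceType) (n : nat) (p q : gauss_phrase T n) :
  homotopic p q -> S_invariant p = S_invariant q.
Proof.
elim=> {p q} [p q|//|p q _ -> //|p q r _ -> _ -> //].
case=> [/isomorphic_S|/shift_S|[/H1_S|/H2_S|/H3_S]] //.
Qed.
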